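(* Let $\sigma\in\mathcal{W}_{2,ac}(\mathbb{R}^n)$ and $\mu\in\mathcal{W}_2(\mathbb{R}^n)$ be such that $T_\sigma^\mu\in\mathfrak{S}(P)$ for some $P\in O(n)$. Then $\mathcal{U}(\sigma,\mu,P)=\mu$ and $T_{\sigma,\mu;P}=T_\sigma^\mu$ ($\sigma$-a.e.).
   Context: $\mathcal{W}_2(\mathbb{R}^n)$ is the set of Borel probability measures on $\mathbb{R}^n$ with finite second moment, and $\mathcal{W}_{2,ac}(\mathbb{R}^n)$ the subset of those absolutely continuous with respect to Lebesgue measure. $T_\sigma^\mu$ is the ($\sigma$-a.e. unique) optimal transport map, i.e. the minimizer of $\int\|T(x)-x\|^2d\sigma(x)$ over maps with $T_\sharp\sigma=\mu$; equivalently the unique gradient of a convex function pushing $\sigma$ to $\mu$. Maps are identified when equal $\sigma$-a.e. For $P=[\theta_1,\ldots,\theta_n]\in O(n)$ (orthogonal matrix with columns $\theta_i$), the set of $P$-compatible maps is $\mathfrak{S}(P)=\{x\mapsto\sum_{i=1}^nf_i(x\cdot\theta_i)\theta_i:\ f_i:\mathbb{R}\to\mathbb{R}\text{ increasing}\}$, where increasing means $s\le t\Rightarrow f_i(s)\le f_i(t)$. For $\theta\in S^{n-1}$, $\sigma^\theta$ is the pushforward of $\sigma$ under $x\mapsto x\cdot\theta$. For one-dimensional measures $\alpha$ (absolutely continuous) and $\beta$, $T_\alpha^\beta=F_\beta^{-1}\circ F_\alpha$ is the optimal transport map ($F_\alpha$ the cumulative distribution function, $F_\beta^{-1}$ the quantile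 function), i.e. the $\alpha$-a.e. unique nondecreasing map pushing $\alpha$ to $\beta$. $T_{\sigma,\mu;P}(x)=\sum_{i=1}^nT_{\sigma^{\theta_i}}^{\mu^{\theta_i}}(x\cdot\theta_i)\,\theta_i$ and $\mathcal{U}(\sigma,\mu,P)=(T_{\sigma,\mu;P})_\sharp\sigma$. *)

(* Defs.v *)
From HB Require Import structures.
From mathcomp Require Import all_boot all_order all_algebra.
From mathcomp Require Import all_classical all_reals all_analysis.
From mathcomp Require Import measurable_realfun.

Set Implicit Arguments.
Unset Strict Implicit.
Unset Printing Implicit Defensive.

Import Order.TTheory GRing.Theory Num.Theory.
Import numFieldNormedType.Exports.

Local Open Scope classical_set_scope.
Local Open Scope ring_scope.

(* R^n is [n.-tuple R] with the product sigma-algebra of the Borel sets of R,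
   i.e. the Borel sigma-algebra of R^n. *)

Section lebesgue_measure_tuple.
Context {R : realType}.

Definition cons_pair (n : nat) (z : measurableTypeR R * n.-tuple R) :
  n.+1.-tuple R := [tuple of z.1 :: z.2].

Lemma measurable_cons_pair (n : nat) : measurable_fun setT (@cons_pair n).
Proof.
exact: (@measurable_cons _ _ _ R fst n snd measurable_fst measurable_snd).
Qed.

(* Image of lebesgue_measure \x m under R x R^n ~ R^n.+1. *)
Definition lebesgue_cons (n : nat)
    (m : {sigma_finite_measure set (n.-tuple R) -> \bar R}) :
    set (n.+1.-tuple R) -> \bar R :=
  pushforward (product_measure1 (@lebesgue_measure R) m) (@cons_pair n).

Section lebesgue_cons_measure.
Context (n : nat) (m : {sigma_finite_measure set (n.-tuple R) -> \bar R}).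

Let lm : {sigma_finite_measure set (measurableTypeR R) -> \bar R} :=
  lebesgue_measure.

Let pm : {measure set _ -> \bar R} := product_measure1 lm m.

Let measurable_preimage_cons_pair (A : set (n.+1.-tuple R)) :
  measurable A -> measurable (@cons_pair n @^-1` A).
Proof.
by move=> mA; rewrite -[X in measurable X]setTI; exact: measurable_cons_pair.
Qed.

Let lebesgue_cons0 : lebesgue_cons m set0 = 0%E.
Proof. by rewrite /lebesgue_cons /pushforward preimage_set0 (measure0 pm). Qed.

Let lebesgue_cons_ge0 A : (0 <= lebesgue_cons m A)%E.
Proof. exact: (measure_ge0 pm). Qed.

Let lebesgue_cons_semi_sigma_additive :
  semi_sigma_additive (lebesgue_cons m).
Proof.
move=> F mF tF mUF; rewrite /lebesgue_cons /pushforward preimage_bigcup.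
apply: (@measure_semi_sigma_additive _ _ _ pm).
- by move=> k; exact: measurable_preimage_cons_pair.
- apply/trivIsetP => /= i j _ _ ij; rewrite -preimage_setI.
  by move/trivIsetP : tF => /(_ _ _ _ _ ij) ->//; rewrite preimage_set0.
- by rewrite -preimage_bigcup; exact: measurable_preimage_cons_pair.
Qed.

HB.instance Definition _ := isMeasure.Build _ _ _ (lebesgue_cons m)
  lebesgue_cons0 lebesgue_cons_ge0 lebesgue_cons_semi_sigma_additive.

Let lebesgue_cons_sigma_finite : sigma_finite setT (lebesgue_cons m).
Proof.
have /sigma_finiteP[F [TF ndF Foo]] := sigma_finiteT lm.
have /sigma_finiteP[G [TG ndG Goo]] := sigma_finiteT m.
pose u (x : n.+1.-tuple R) : measurableTypeR R * n.-tuple R :=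
  (tnth x ord0, [tuple of behead x]).
have cK : cancel (@cons_pair n) u.
  by move=> [a t]; rewrite /u /cons_pair /=; congr pair; apply/val_inj.
have mu : measurable_fun setT u.
  apply/measurable_fun_pairP; split; first exact: measurable_tnth.
  exact: measurable_behead.
exists (fun k => u @^-1` (F k `*` G k)).
  rewrite -preimage_bigcup (_ : \bigcup_k _ = setT) ?preimage_setT//.
  rewrite -subTset => -[x y] _.
  have [i _ Fix] : (\bigcup_i F i) x by rewrite -TF.
  have [j _ Gjy] : (\bigcup_i G i) y by rewrite -TG.
  exists (maxn i j) => //; split.
    by move: Fix; exact/subsetPset/ndF/leq_maxl.
  by move: Gjy; exact/subsetPset/ndG/leq_maxr.
move=> k; have [mF Fkoo] := Foo k; have [mG Gkoo] := Goo k; split.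
  by rewrite -[X in measurable X]setTI; apply: mu => //; exact: measurableX.
rewrite /lebesgue_cons /pushforward -comp_preimage.
rewrite (_ : u \o @cons_pair n = id); last exact/funext.
by rewrite preimage_id product_measure1E// lte_mul_pinfty// ge0_fin_numE.
Qed.

HB.instance Definition _ := Measure_isSigmaFinite.Build _ _ _
  (lebesgue_cons m) lebesgue_cons_sigma_finite.

End lebesgue_cons_measure.

Fixpoint lebesgue_measure_tuple (n : nat) :
    {sigma_finite_measure set (n.-tuple R) -> \bar R} :=
  match n with
  | 0%N => \d_([tuple] : 0.-tuple R)
  | k.+1 => lebesgue_cons (lebesgue_measure_tuple k)
  end.

Lemma lebesgue_measure_tuple_box (n : nat) (A : 'I_n -> set R) :
  (forall i, measurable (A i)) ->
  lebesgue_measure_tuple n [set x | forall i, A i (tnth x i)] =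
  (\prod_(i < n) lebesgue_measure (A i))%E.
Proof.
elim: n A => [|n IHn] A mA.
  by rewrite big_ord0 /= diracE mem_set//= => -[].
rewrite big_ord_recl -IHn//=.
rewrite /lebesgue_cons /pushforward.
have -> : @cons_pair n @^-1` [set x | forall i, A i (tnth x i)] =
    A ord0 `*` [set x | forall i, A (lift ord0 i) (tnth x i)].
  apply/seteqP; split => [[a t]/= At|[a t]/= [Aa At] i].
    by split => [|i]; [exact: (At ord0)|move: (At (lift ord0 i)); rewrite tnthS].
  by have [j ->|->//] := unliftP ord0 i; rewrite tnthS.
rewrite product_measure1E//; first exact: mA.
have -> : [set x : n.-tuple R | forall i, A (lift ord0 i) (tnth x i)] =
    \bigcap_(i in [set: 'I_n]) ((@tnth n R)^~ i @^-1` A (lift ord0 i)).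
  by apply/seteqP; split => x /= Ax i; [move=> _|]; exact: Ax.
apply: fin_bigcap_measurable => // i _.
by rewrite -[X in measurable X]setTI; exact: measurable_tnth.
Qed.

End lebesgue_measure_tuple.
Arguments lebesgue_measure_tuple {R} n.

Section euclidean_space.
Context {R : realType} {n : nat}.
Implicit Types x y theta : n.-tuple R.

Definition dot x y : R := \sum_(j < n) tnth x j * tnth y j.

Definition sqdist x y : R := \sum_(j < n) (tnth x j - tnth y j) ^+ 2.

Definition proj theta x : R := dot x theta.

Lemma measurable_proj theta : measurable_fun setT (proj theta).
Proof.
apply: measurable_sum => j.
by apply: measurable_funM => //; exact: measurable_tnth.
Qed.

HB.instance Definition _ theta :=
  isMeasurableFun.Build _ _ _ _ (proj theta) (measurable_proj theta).

End euclidean_space.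

Section wasserstein_space.
Context {R : realType} {n : nat}.

Definition W2 : set (probability (n.-tuple R) R) :=
  [set mu | (\int[mu]_x (dot x x)%:E < +oo)%E].

Definition W2ac : set (probability (n.-tuple R) R) :=
  W2 `&` [set mu | mu `<< lebesgue_measure_tuple n].

Definition pushes (T : n.-tuple R -> n.-tuple R)
    (sigma mu : probability (n.-tuple R) R) : Prop :=
  measurable_fun setT T /\
  forall A, measurable A -> pushforward sigma T A = mu A.

Definition transport_cost (sigma : probability (n.-tuple R) R)
    (T : n.-tuple R -> n.-tuple R) : \bar R :=
  (\int[sigma]_x (sqdist (T x) x)%:E)%E.

(* [optimal_map sigma mu T] : T is (a version of) the optimal transport map
   from sigma to mu, which is only defined sigma-a.e. *)
Definition optimal_map (sigma mu : probability (n.-tuple R) R)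
    (T : n.-tuple R -> n.-tuple R) : Prop :=
  pushes T sigma mu /\
  forall S, pushes S sigma mu ->
    (transport_cost sigma T <= transport_cost sigma S)%E.

Definition marginal (sigma : probability (n.-tuple R) R)
    (theta : n.-tuple R) : probability R R :=
  distribution sigma (proj theta).

End wasserstein_space.

Section one_dimensional_transport.
Context {R : realType}.
Implicit Types alpha beta : probability R R.

#[local] HB.instance Definition _ :=
  @isMeasurableFun.Build _ _ R R (@idfun R) (@measurable_id _ R setT).

Definition cdf1 alpha : R -> \bar R := cdf (@idfun R : {RV alpha >-> R}).

Definition quantile beta (p : \bar R) : \bar R :=
  ereal_inf [set t%:E | t in [set t | (p <= cdf1 beta t)%E]].

(* The quantile function may be infinite at 0 and 1, where [fine] returns 0:
   for atomless alpha this only affects an alpha-null set of arguments. *)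
Definition transport1 alpha beta (t : R) : R :=
  fine (quantile beta (cdf1 alpha t)).

Lemma measurable_transport1 alpha beta :
  measurable_fun setT (transport1 alpha beta).
Proof.
suff mq : measurable_fun setT (fun t => quantile beta (cdf1 alpha t)).
  exact: (measurableT_comp (fine_measurable _) mq).
apply: (measurability _ (ErealGenOInfty.measurableE R)) => // _ [_ [x ->] <-].
rewrite setTI; apply: is_interval_measurable => s t /= Qs Qt u /andP[su _].
move: Qs; rewrite !in_itv/= !andbT => /lt_le_trans; apply.
apply: ereal_inf_le_tmp => _ [r /= ur <-]; exists r => //=.
exact: (le_trans (cdf_nondecreasing _ su)).
Qed.

HB.instance Definition _ alpha beta :=
  isMeasurableFun.Build _ _ _ _ (transport1 alpha beta)
    (measurable_transport1 alpha beta).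

End one_dimensional_transport.

Section compatible_maps.
Context {R : realType} {n : nat}.
Implicit Types (P : 'M[R]_n) (sigma mu : probability (n.-tuple R) R).

Definition orthogonal_mx P : Prop := P^T *m P = 1%:M.

Definition col_tuple P (i : 'I_n) : n.-tuple R := [tuple P j i | j < n].

(* x |-> \sum_i f_i (x . theta_i) theta_i, with theta_i the columns of P *)
Definition slice_map P (f : 'I_n -> R -> R) (x : n.-tuple R) : n.-tuple R :=
  [tuple \sum_(i < n) f i (dot x (col_tuple P i)) * tnth (col_tuple P i) j
  | j < n].

Definition compatible_maps P : set (n.-tuple R -> n.-tuple R) :=
  [set slice_map P f | f in
    [set f : 'I_n -> R -> R | forall i, {homo f i : s t / s <= t}]].

Definition slice_transport sigma mu P : n.-tuple R -> n.-tuple R :=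
  slice_map P (fun i => transport1 (marginal sigma (col_tuple P i))
                                   (marginal mu (col_tuple P i))).

Lemma measurable_slice_transport sigma mu P :
  measurable_fun setT (slice_transport sigma mu P).
Proof.
apply/measurable_fun_tnthP => j.
rewrite (_ : _ \o _ = fun x => \sum_(i < n)
    transport1 (marginal sigma (col_tuple P i)) (marginal mu (col_tuple P i))
      (proj (col_tuple P i) x) * tnth (col_tuple P i) j); last first.
  by apply/funext => x /=; rewrite tnth_mktuple.
apply: measurable_sum => i; apply: measurable_funM => //.
by apply: measurableT_comp; [exact: measurable_transport1|exact: measurable_proj].
Qed.

HB.instance Definition _ sigma mu P :=
  isMeasurableFun.Build _ _ _ _ (slice_transport sigma mu P)
    (measurable_slice_transport sigma mu P).

Definition slice_update sigma mu P : probability (n.-tuple R) R :=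
  distribution sigma (slice_transport sigma mu P).

End compatible_maps.

(* Main.v *)
Require Import Defs.
From HB Require Import structures.
From mathcomp Require Import all_boot all_order all_algebra.
From mathcomp Require Import all_classical all_reals all_analysis.
From mathcomp Require Import measurable_realfun.

Set Implicit Arguments.
Unset Strict Implicit.
Unset Printing Implicit Defensive.

Import Order.TTheory GRing.Theory Num.Theory.
Import numFieldNormedType.Exports.

Local Open Scope classical_set_scope.
Local Open Scope ring_scope.

(* A nondecreasing f with f_# alpha = beta is alpha-a.e. the quantile transport:
   Q_beta(F_alpha(s)) <= f(s) always holds, and if it is strict then f jumps over
   some rational q < f(s) with alpha {u <= s, q < f u} = 0; for each q such s form
   an alpha-null set.  If T(x) = sum_i f_i(x.theta_i) theta_i, orthonormality
   gives T(x).theta_i = f_i(x.theta_i), so f_i pushes the theta_i-marginal of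
   sigma to that of mu, and f_i is the transport map between these marginals. *)

Lemma ae_forall_countable d (T : sigmaRingType d) (R : realType)
    (mu : {measure set T -> \bar R}) (I : countType) (P : I -> T -> Prop) :
  (forall i, \forall x \ae mu, P i x) -> \forall x \ae mu, forall i, P i x.
Proof.
move=> aeP.
(* Codes [k] that decode to no index get the trivial predicate. *)
have aeQ k : \forall x \ae mu, if unpickle k is Some i then P i x else True.
  by case: (unpickle k) => [i|]; [exact: aeP|exact: aeW].
have := ae_foralln aeQ; apply: filterS => x Px i.
by have := Px (pickle i); rewrite pickleK.
Qed.

Lemma ae_distribution d d' (T : measurableType d) (U : measurableType d')
    (R : realType) (mu : probability T R) (X : {mfun T >-> U}) (P : U -> Prop) :
  (\forall u \ae distribution mu X, P u) -> \forall x \ae mu, P (X x).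
Proof.
move=> [N [mN N0 PN]]; exists (X @^-1` N); split => //.
by rewrite -[X in measurable X]setTI; exact: measurable_funPT.
by move=> x /= PXx; exact: PN.
Qed.

Lemma eq_measure_ae d (T : measurableType d) (R : realType)
    (mu : {measure set T -> \bar R}) (A B : set T) :
  measurable A -> measurable B -> (\forall x \ae mu, A x <-> B x) ->
  mu A = mu B.
Proof.
move=> mA mB [N [mN N0 AN]].
have AB C D : measurable C -> measurable D -> C `\` D `<=` N -> (mu C <= mu D)%E.
  move=> mC mD CDN; apply: (@le_trans _ _ (mu (D `|` N))).
    apply: le_measure; rewrite ?inE//; first exact: measurableU.
    move=> x Cx; have [Dx|nDx] := pselect (D x); [by left|right].
    exact: CDN.
  by rewrite -[leRHS]adde0 -[X in (_ + X)%E]N0; exact: measureU2.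
apply/eqP; rewrite eq_le; apply/andP; split; apply: AB => // x [Cx nDx].
- by apply: AN => /= -[/(_ Cx)].
- by apply: AN => /= -[_ /(_ Cx)].
Qed.

Section monotone_transport.
Context {R : realType} (alpha beta : probability R R) (f : R -> R).
Hypothesis f_homo : {homo f : s t / s <= t}.

(** When this set is [alpha]-null, [f] is at most [q] almost everywhere on []-oo, s]]; under
    [beta_push] this gives [F_alpha(s) <= F_beta(q)], so the quantile at [F_alpha(s)] is at most
    [q]. *)
Let left_above q s : set R := `]-oo, s] `&` f @^-1` `]q, +oo[.

Let measurable_preimage_homo (A : set R) :
  measurable A -> measurable (f @^-1` A).
Proof.
move=> mA; rewrite -[X in measurable X]setTI.
exact: (nondecreasing_measurable (@measurableT _ _) f_homo).
Qed.

Let measurable_left_above q s : measurable (left_above q s).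
Proof. by apply: measurableI => //; exact: measurable_preimage_homo. Qed.

(** The exceptional points [s] lie in their own null sets [left_above q s]. These are uncountably
    many but grow with [s], so a largest exceptional point, or else the rational ones, suffice to
    cover all. *)
Lemma ae_left_above_neq0 (q : R) :
  \forall s \ae alpha, q < f s -> alpha (left_above q s) <> 0%E.
Proof.
pose B := [set s | q < f s /\ alpha (left_above q s) = 0%E].
have aeB s : B s -> \forall u \ae alpha, ~ (u <= s /\ q < f u).
  move=> [_ s0]; exists (left_above q s); split => // u /= /contrapT[us qu].
  by rewrite /left_above /= !in_itv/= us andbT.
suff : \forall s \ae alpha, ~ B s.
  by apply: filterS => s nBs qs s0; exact: nBs.
have [[s0 [Bs0 maxs0]]|nomax] := pselect (exists s0, B s0 /\ forall s, B s -> s <= s0).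
  apply: (filterS _ (aeB _ Bs0)) => s + Bs; apply; split; first exact: maxs0.
  by case: Bs.
(* Without a maximum, [B] is covered by the null sets [left_above q r] with [r]
   a rational point of [B]. *)
have : \forall u \ae alpha, forall r : rat,
    B (ratr r) -> ~ (u <= ratr r /\ q < f u).
  apply: ae_forall_countable => r.
  have [/aeB|nBr] := pselect (B (ratr r)); first exact: filterS.
  exact: aeW.
(* A point [s] of [B] outside these null sets would be a maximum of [B]: a rational [r] between [s]
   and a larger [s'] in [B] is itself in [B], because [q < f s <= f r] and [left_above q r] is
   inside [left_above q s'], and then the null set of [r] contains [s]. *)
apply: filterS => s ratB Bs; apply: nomax; exists s; split => // s' [qs' s'0].
rewrite leNgt; apply/negP => ss'.
have [r] := rat_in_itvoo ss'; rewrite in_itv/= => /andP[sr rs'].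
have [qs _] := Bs.
apply: (ratB r) => //; last by rewrite ltW.
split; first exact: (lt_le_trans qs (f_homo (ltW sr))).
apply/eqP; rewrite eq_le measure_ge0 andbT -s'0.
apply: le_measure; rewrite ?inE//; apply: setSI => u /=.
by rewrite !in_itv/= => /le_trans; apply; exact: ltW.
Qed.

Hypothesis beta_push :
  forall t, beta `]-oo, t]%classic = alpha (f @^-1` `]-oo, t]).

Lemma transport1_homo : transport1 alpha beta = f %[ae alpha].
Proof.
have : \forall s \ae alpha, forall q : rat,
    ratr q < f s -> alpha (left_above (ratr q) s) <> 0%E.
  by apply: ae_forall_countable => q; exact: ae_left_above_neq0.
apply: filterS => s above _; rewrite /transport1.
(* At such [s] the quantile is finite, so the default value of [fine] does not interfere. *)
suff -> : quantile beta (cdf1 alpha s) = (f s)%:E by [].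
apply/eqP; rewrite eq_le; apply/andP; split.
  apply: ereal_inf_lbound; exists (f s) => //=.
  rewrite /cdf1 /cdf /distribution /pushforward /= !preimage_id beta_push.
  apply: le_measure; rewrite ?inE//; first exact: measurable_preimage_homo.
  by move=> u /=; rewrite !in_itv/=; exact: f_homo.
(* Lower bound: suppose [F_alpha(s) <= F_beta(t)] with [t < f s], and take a rational [q] in
   between. The set [f @^-1] []-oo, t]] lies in the complement [C] of [left_above q s] in []-oo,
   s]]; cancelling the finite mass of [C] makes [left_above q s] null. *)
apply: le_ereal_inf_tmp => _ [t /= + <-].
rewrite /cdf1 /cdf /distribution /pushforward /= !preimage_id beta_push => le_st.
rewrite lee_fin leNgt; apply/negP => tfs.
have [q] := rat_in_itvoo tfs; rewrite in_itv/= => /andP[tq qfs].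
apply: (above q qfs).
pose C := `]-oo, s] `&` ~` (f @^-1` `](ratr q), +oo[).
have mC : measurable C.
  apply: measurableI => //; apply: measurableC; exact: measurable_preimage_homo.
have le_C : (alpha (f @^-1` `]-oo, t]) <= alpha C)%E.
  apply: le_measure; rewrite ?inE//; first exact: measurable_preimage_homo.
  move=> u /=; rewrite !in_itv/= => fut; split.
    rewrite /= in_itv/= leNgt; apply/negP => /ltW /f_homo fsu.
    by have := lt_le_trans tfs (le_trans fsu fut); rewrite ltxx.
  by apply/negP; rewrite in_itv/= andbT -leNgt (le_trans fut)// ltW.
have Cfin : alpha C \is a fin_num by exact: fin_num_measure.
have splitC : alpha `]-oo, s]%classic =
    (alpha (left_above (ratr q) s) + alpha C)%E.
  rewrite -measureU//; first by rewrite -setIUr setUv setIT.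
  by rewrite /left_above /C setIACA setICr setI0.
have := le_trans le_st le_C; rewrite splitC -leeBrDr// subee// => le0.
by apply/eqP; rewrite eq_le measure_ge0 andbT.
Qed.

End monotone_transport.

Section orthogonal_slices.
Context (R : realType) (n : nat) (P : 'M[R]_n).
Hypothesis P_orthogonal : orthogonal_mx P.

Lemma dot_col_tuple (i k : 'I_n) :
  dot (col_tuple P i) (col_tuple P k) = (i == k)%:R.
Proof.
have /matrixP/(_ i k) := P_orthogonal; rewrite !mxE => <-.
by apply: eq_bigr => j _; rewrite !tnth_mktuple mxE.
Qed.

Lemma proj_slice_map (f : 'I_n -> R -> R) (i : 'I_n) (x : n.-tuple R) :
  Defs.proj (col_tuple P i) (slice_map P f x) =
  f i (Defs.proj (col_tuple P i) x).
Proof.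
transitivity (\sum_(k < n) f k (Defs.proj (col_tuple P k) x) *
    dot (col_tuple P k) (col_tuple P i)).
  rewrite /Defs.proj {1}/dot.
  under eq_bigr => j _ do rewrite tnth_mktuple mulr_suml.
  rewrite exchange_big/=; apply: eq_bigr => k _.
  by rewrite mulr_sumr; apply: eq_bigr => j _; rewrite mulrA.
rewrite (bigD1 i)//= dot_col_tuple eqxx mulr1 big1 ?addr0// => k /negbTE ki.
by rewrite dot_col_tuple ki mulr0.
Qed.

End orthogonal_slices.

Theorem corollary4p7 (R : realType) (n : nat)
    (sigma mu : probability (n.-tuple R) R)
    (T : n.-tuple R -> n.-tuple R) (P : 'M[R]_n)
    (hsigma : W2ac sigma) (hmu : W2 mu)
    (hT : optimal_map sigma mu T)
    (hP : orthogonal_mx P)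
    (hTP : exists2 S, compatible_maps P S & T = S %[ae sigma]) :
  (forall A, measurable A -> slice_update sigma mu P A = mu A) /\
  slice_transport sigma mu P = T %[ae sigma].
Proof.
have [[mT Tpush] _] := hT; have [_ [f f_homo <-] TS] := hTP.
have aeT : slice_transport sigma mu P = T %[ae sigma].
  have aei : \forall x \ae sigma, forall i,
      transport1 (marginal sigma (col_tuple P i)) (marginal mu (col_tuple P i))
        (Defs.proj (col_tuple P i) x) = f i (Defs.proj (col_tuple P i) x).
    apply: ae_forall_countable => i; set theta := col_tuple P i.
    (* An equality holding a.e. for the marginal on the line pulls back along the projection to one
       holding [sigma]-a.e. *)
    apply: (@ae_distribution _ _ _ _ _ sigma (Defs.proj theta)
      (fun t => transport1 (marginal sigma theta) (marginal mu theta) t = f i t)).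
    suff : transport1 (marginal sigma theta) (marginal mu theta) = f i
        %[ae marginal sigma theta] by apply: filterS => t; exact.
    apply: transport1_homo => [|t]; first exact: f_homo.
    (* Half-lines have the same mass on both sides: [mu] is the image of [sigma] under [T], and the
       projection of [T x] is a.e. [f i] of the projection of [x]. *)
    rewrite -[LHS]/(mu (Defs.proj theta @^-1` `]-oo, t])) -Tpush; last first.
      by rewrite -[X in measurable X]setTI; exact: Defs.measurable_proj.
    rewrite -[RHS]/(sigma (Defs.proj theta @^-1` (f i @^-1` `]-oo, t]))).
    rewrite /pushforward.
    apply: eq_measure_ae.
    - rewrite -[X in measurable X]setTI; apply: mT => //.
      by rewrite -[X in measurable X]setTI; exact: Defs.measurable_proj.
    - rewrite -[X in measurable X]setTI; apply: Defs.measurable_proj => //.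
      rewrite -[X in measurable X]setTI.
      by apply: nondecreasing_measurable => //; exact: f_homo.
    - apply: (filterS _ TS) => x /(_ Logic.I) Tx.
      by rewrite /= Tx proj_slice_map.
  apply: (filterS2 _ _ TS aei) => x /(_ Logic.I) -> eqx _.
  by apply: eq_from_tnth => j; rewrite !tnth_mktuple; apply: eq_bigr => i _; rewrite eqx.
(* The image of [sigma] depends only on the a.e. class of the map. *)
split => // A mA; rewrite -[LHS]/(sigma (slice_transport sigma mu P @^-1` A)) -Tpush// /pushforward.
apply: eq_measure_ae.
- by rewrite -[X in measurable X]setTI; exact: measurable_slice_transport.
- by rewrite -[X in measurable X]setTI; exact: mT.
- by apply: (filterS _ aeT) => x /(_ Logic.I) eqx; rewrite /= eqx.
Qed.
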